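(* Let $\mathbf{u}:\mathbb{R}_+\times\mathbb{R}^N\to\mathbb{R}^m$ be a function locally bounded from above satisfying the sub-optimality principle. Then $\mathbf{u}$ is a (viscosity) subsolution of the system $$\partial_t u_i+H_i(x,D_xu_i)+\big(B\mathbf{u}(t,x)\big)_i=0\quad\text{in }(0,+\infty)\times\mathbb{R}^N,\qquad i\in\{1,\dots,m\}.$$
   Context: $N,m\ge 1$ are integers, $\mathbb{R}_+=[0,+\infty)$. The Hamiltonians $H_1,\dots,H_m:\mathbb{R}^N\times\mathbb{R}^N\to\mathbb{R}$ satisfy: each $H_i$ is uniformly continuous on $\mathbb{R}^N\times B_R$ for every $R>0$ ($B_R$ the open ball of radius $R$ centred at $0$); $p\mapsto H_i(x,p)$ is convex for every $x$; there are superlinear functions $\alpha,\beta:\mathbb{R}_+\to\mathbb{R}$ (i.e. $\alpha(h)/h\to+\infty$, $\beta(h)/h\to+\infty$ as $h\to+\infty$) with $\alpha(|p|)\le H_i(x,p)\le\beta(|p|)$ for all $(x,p)$. The Lagrangians are $L_i(x,q)=\sup_{p}\{\langle p,q\rangle-H_i(x,p)\}$. $B=(b_{ij})$ is a real $m\times m$ matrix with $b_{ij}\le 0$ for $j\ne i$ and $\sum_{j}b_{ij}=0$ for every $i$; $(B\mathbf{u})_i=\sum_jb_{ij}u_j$. Viscosity subsolution: for $\mathbf{u}$ locally bounded from above, $u_i^*(t,x)=\limsup_{(s,y)\to(t,x)}u_i(s,y)$ is the upper semicontinuous envelope; $D^+u_i^*(t,x)$ is the set of $(\partial_t\phi(t,x),D_x\phi(t,x))$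 with $\phi$ of class $C^1$ near $(t,x)$ such that $u_i^*-\phi$ has a local maximum at $(t,x)$. $\mathbf{u}$ is a subsolution if $p_t+H_i(x,p_x)+(B\mathbf{u}^*(t,x))_i\le 0$ for every $(t,x)\in(0,+\infty)\times\mathbb{R}^N$, every $i$ and every $(p_t,p_x)\in D^+u_i^*(t,x)$. Random frame: $\Omega$ is the space of right-continuous paths $\omega:\mathbb{R}_+\to\{1,\dots,m\}$ with left limits; $\mathcal{F}$ is the $\sigma$-algebra generated by the evaluation maps $\omega\mapsto\omega(t)$, $t\ge0$. $\Omega_i=\{\omega:\omega(0)=i\}$. $\mathbb{P}$ is a probability measure on $(\Omega,\mathcal{F})$ under which $(\omega(t))_{t\ge0}$ is a Markov chain with generator matrix $-B$ (transition matrices $e^{-Bt}$), with $\mathbb{P}(\Omega_i)>0$ for each $i$; $\mathbb{P}_i$ is $\mathbb{P}$ conditioned to $\Omega_i$ (the law of the chain started at $i$) and $\mathbb{E}_i$ the corresponding expectation. Sub-optimality principle: $\mathbf{u}:\mathbb{R}_+\times\mathbb{R}^N\to\mathbb{R}^m$ satisfies it if $$u_i(t_0+h,\gamma(0))-\mathbb{E}_i\big[u_{\omega(h)}(t_0,\gamma(h))\big]\le\mathbb{E}_i\Big[\int_0^hL_{\omega(s)}(\gamma(s),-\dot\gamma(s))\,ds\Big]$$ for all $t_0,h\ge0$, all $i\in\{1,\dots,m\}$ and every deterministic locally absolutely continuous curve $\gamma:\mathbb{R}_+\to\mathbb{R}^N$. *)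

(* Defs.v *)
From HB Require Import structures.
From mathcomp Require Import all_boot all_order all_algebra.
From mathcomp Require Import all_classical all_reals all_analysis.

Set Implicit Arguments.
Unset Strict Implicit.
Unset Printing Implicit Defensive.

Import Order.TTheory GRing.Theory Num.Theory numFieldNormedType.Exports.

Local Open Scope classical_set_scope.
Local Open Scope ring_scope.

(* Conventions: R^N is 'rV[R]_n.+1 and the index set {1,...,m} is 'I_m.+1, so  *)
(* the dimensions N = n.+1 and m.+1 range over the positive integers. A        *)
(* function on R_+ (resp. R_+ x R^N) is a total function on R (resp.           *)
(* R * R^N) of which only the values at nonnegative times are used.            *)

Section Euclidean.
Variables (R : realType) (n : nat).
Implicit Types p q : 'rV[R]_n.

Definition dotp p q : R := \sum_j p 0 j * q 0 j.

(* The library norm on 'rV is the maximum norm. *)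
Definition enorm p : R := Num.sqrt (dotp p p).

End Euclidean.

Section Hamiltonians.
Variables (R : realType) (n m : nat).
Local Notation E := 'rV[R]_n.+1.
Implicit Types (H : 'I_m.+1 -> E -> E -> R).

Definition unif_continuous_on_balls (F : E -> E -> R) :=
  forall r : R, 0 < r -> forall e : R, 0 < e -> exists2 d : R, 0 < d &
    forall x y p q : E, enorm p < r -> enorm q < r ->
      enorm (x - y) < d -> enorm (p - q) < d -> `|F x p - F y q| < e.

Definition superlinear (alpha : R -> R) :=
  alpha h / h @[h --> +oo] --> +oo.

Definition hamiltonians H :=
  [/\ forall i, unif_continuous_on_balls (H i),
      forall i x, convex_function [set: E] (H i x) &
      exists alpha beta : R -> R,
        [/\ superlinear alpha, superlinear beta &
            forall i x p, alpha (enorm p) <= H i x p <= beta (enorm p)]].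

(* L_i(x, q); the supremum is taken in the extended reals. *)
Definition lagrangian H (i : 'I_m.+1) (x q : E) : \bar R :=
  ereal_sup [set (dotp p q - H i x p)%:E | p in [set: E]].

End Hamiltonians.

Definition coupling_matrix (R : realType) (m : nat) (B : 'M[R]_m.+1) :=
  (forall i j, j != i -> B i j <= 0) /\ (forall i, \sum_j B i j = 0).

Section Viscosity.
Variables (R : realType) (n m : nat).
Local Notation E := 'rV[R]_n.+1.
Implicit Types (u : 'I_m.+1 -> R * E -> R) (v phi : R * E -> R) (z : R * E).

Definition halfspace : set (R * E) := [set z | 0 <= z.1].

Definition locally_bounded_above u :=
  forall z, halfspace z -> exists M : R,
    \forall z' \near within halfspace (nbhs z), forall i, u i z' <= M.

(* The limsup at z includes the value at z itself. It is finite when v is      *)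
(* locally bounded from above.                                                 *)
Definition usc_env v z : R :=
  fine (limf_esup (fun z' => (v z')%:E) (within halfspace (nbhs z))).

Definition C1_near phi z :=
  \forall z' \near z, differentiable phi z' /\
    forall w : R * E, {for z', continuous (fun z'' => 'D_w phi z'')}.

Definition time_deriv phi z : R := 'D_((1, 0) : R * E) phi z.

Definition space_grad phi z : E :=
  \row_j 'D_((0, delta_mx 0 j) : R * E) phi z.

Definition superdiff v z : set (R * E) :=
  [set p | exists phi, [/\ C1_near phi z,
     \forall z' \near z, v z' - phi z' <= v z - phi z &
     p = (time_deriv phi z, space_grad phi z)]].

Definition subsolution (H : 'I_m.+1 -> E -> E -> R) (B : 'M[R]_m.+1) u :=
  forall (t : R) (x : E), 0 < t -> forall (i : 'I_m.+1) (pt : R) (px : E),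
    superdiff (usc_env (u i)) (t, x) (pt, px) ->
    pt + H i x px + \sum_j B i j * usc_env (u j) (t, x) <= 0.

End Viscosity.

Section PathSpace.
Variables (R : realType) (m : nat).

(* The last clause extends a path on R_+ to R in a unique way; since the state *)
(* space is discrete, converging means being eventually constant.              *)
Definition cadlag (w : R -> 'I_m.+1) :=
  [/\ forall t, 0 <= t -> \forall s \near t^'+, w s = w t,
      forall t, 0 < t -> exists j, \forall s \near t^'-, w s = j &
      forall t, t < 0 -> w t = w 0].

Record rcll_path := RcllPath {
  rcll_fun :> R -> 'I_m.+1 ;
  rcll_cadlag : cadlag rcll_fun }.

Lemma cadlag_cst (j : 'I_m.+1) : cadlag (fun=> j).
Proof.
by split=> // t _; [exact: nearW | exists j; exact: nearW].
Qed.

HB.instance Definition _ := gen_eqMixin rcll_path.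
HB.instance Definition _ := gen_choiceMixin rcll_path.
HB.instance Definition _ := isPointed.Build rcll_path (RcllPath (cadlag_cst ord0)).

Definition evaluation_events : set (set rcll_path) :=
  [set A | exists t j, 0 <= t /\ A = [set w : rcll_path | w t = j]].

Definition starts_at (i : 'I_m.+1) : set (g_sigma_algebraType evaluation_events) :=
  [set w : rcll_path | w 0 = i].

Lemma measurable_starts_at i : measurable (starts_at i).
Proof. by apply: sub_sigma_algebra; exists 0, i. Qed.

End PathSpace.

Notation pathSpace R m := (g_sigma_algebraType (@evaluation_events R m)).

Section MarkovChain.
Variables (R : realType) (m : nat).
Local Notation Omega := (pathSpace R m).
Implicit Types P : probability Omega R.

Definition expmx (A : 'M[R]_m.+1) : 'M[R]_m.+1 :=
  limn (series (fun k => k`!%:R^-1 *: A ^+ k)).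

Definition cylinder (t : nat -> R) (j : nat -> 'I_m.+1) (k : nat) : set Omega :=
  [set w : rcll_path R m | forall l, (l <= k)%N -> w (t l) = j l].

(* P(w(t_(k+1)) = j_(k+1) | w(t_0) = j_0, ..., w(t_k) = j_k)                   *)
(*   = (e^(- (t_(k+1) - t_k) B))_(j_k, j_(k+1)),                               *)
(* multiplied by the probability of the conditioning event.                    *)
Definition markov_chain (B : 'M[R]_m.+1) P :=
  forall (k : nat) (t : nat -> R) (j : nat -> 'I_m.+1),
    0 <= t 0%N -> (forall l, (l <= k)%N -> t l <= t l.+1) ->
    P (cylinder t j k.+1) =
    (P (cylinder t j k) * (expmx (- (t k.+1 - t k) *: B) (j k) (j k.+1))%:E)%E.

(* P_i: mnormalize divides by the mass P (starts_at i); its second argument is *)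
(* a default value that is only used when this mass is zero.                   *)
Definition started_at P (i : 'I_m.+1) : probability Omega R :=
  mnormalize (mrestr P (measurable_starts_at i)) P.

End MarkovChain.

Section SubOptimality.
Variables (R : realType) (n m : nat).
Local Notation E := 'rV[R]_n.+1.

Definition loc_abs_continuous (gamma : R -> E) :=
  forall T : R, 0 < T -> forall e : R, 0 < e -> exists2 d : R, 0 < d &
    forall (k : nat) (a b : 'I_k -> R),
      (forall l, 0 <= a l /\ a l <= b l /\ b l <= T) ->
      trivIset [set: 'I_k] (fun l => `]a l, b l[%classic) ->
      \sum_l (b l - a l) < d ->
      \sum_l enorm (gamma (b l) - gamma (a l)) < e.

Definition suboptimality (H : 'I_m.+1 -> E -> E -> R)
    (P : probability (pathSpace R m) R) (u : 'I_m.+1 -> R * E -> R) :=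
  forall t0 h : R, 0 <= t0 -> 0 <= h -> forall (i : 'I_m.+1) (gamma : R -> E),
    loc_abs_continuous gamma ->
    ((u i (t0 + h, gamma 0))%:E
       - \int[started_at P i]_w (u ((w : rcll_path R m) h) (t0, gamma h))%:E
     <= \int[started_at P i]_w \int[lebesgue_measure]_(s in `[0%R, h])
          lagrangian H ((w : rcll_path R m) s) (gamma s) (- derive1 gamma s))%E.

End SubOptimality.

(* Main.v *)
Require Import Defs.
From mathcomp Require Import all_boot all_order all_algebra.
From mathcomp Require Import all_classical all_reals all_analysis.
From mathcomp Require Import ring lra.

(* Let phi touch u_i^* from above at (t, x) and let p = D_x phi(t, x). A       *)
(* subgradient q of the convex function H_i(x, .) at p satisfies               *)
(* L_i(x, q) = <p, q> - H_i(x, p). Apply the sub-optimality principle along    *)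
(* the line s |-> x' - s q from a point (t', x') close to (t, x) at which u_i  *)
(* almost equals u_i^*(t, x). For small h the chain stays in state i on [0, h] *)
(* with probability close to 1, and L_j(., q) is upper semicontinuous, so the  *)
(* right-hand side is at most h (L_i(x, q) + o(1)); on the left-hand side the  *)
(* transition probabilities are (1 - h B)_ij + O(h^2), and u_i^* is replaced   *)
(* by phi. Dividing by h and letting h tend to 0 yields                        *)
(*   phi_t + <p, q> + (B u^* )_i <= L_i(x, q) = <p, q> - H_i(x, p).            *)

(** Choosing [q] so that the supremum defining L_i(x, q) is attained at the gradient p
    ([hamiltonian_subgradient]) makes a single straight line enough: the resulting bound by L_i(x,
    q) is already the inequality for H_i(x, p). Two errors must be controlled along that line.
    Switching of the chain changes the running cost; [path_stays] and [expected_action_le] make this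
    at most h times a multiple of [e], with [lagrangian_lty] bounding the other Lagrangians and
    [lagrangian_usc] their variation in space. The envelope need not be attained; [usc_env_adherent]
    supplies base points where it is missed by less than h^2. The coupling term comes from
    [transition_rate]. The order of limits matters: the event where the chain stays put and the
    neighbourhoods of (t, x) depend on [e], the base point on h. So [test_function_step] fixes [e]
    and takes h small; [suboptimality_subsolution] divides by h, lets h tend to 0, and only then
    [e]. *)

Set Implicit Arguments.
Unset Strict Implicit.
Unset Printing Implicit Defensive.

Import Order.TTheory GRing.Theory Num.Theory numFieldNormedType.Exports.

Local Open Scope classical_set_scope.
Local Open Scope ring_scope.

(** * Subgradients of convex functions *)

Section EuclideanSpace.
Variables (R : realType) (n : nat).
Implicit Types p q v : 'rV[R]_n.

Lemma dotpDl p p' q : dotp (p + p') q = dotp p q + dotp p' q.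
Proof. by rewrite -big_split; apply: eq_bigr => j _; rewrite mxE mulrDl. Qed.

Lemma dotpZl a p q : dotp (a *: p) q = a * dotp p q.
Proof. by rewrite mulr_sumr; apply: eq_bigr => j _; rewrite mxE mulrA. Qed.

Lemma dotpBl p p' q : dotp (p - p') q = dotp p q - dotp p' q.
Proof. by rewrite dotpDl -scaleN1r dotpZl mulN1r. Qed.

Lemma dot0p q : dotp 0 q = 0.
Proof. by rewrite -(scale0r 0) dotpZl mul0r. Qed.

Lemma dotpC p q : dotp p q = dotp q p.
Proof. by apply: eq_bigr => j _; rewrite mulrC. Qed.

Lemma dotp_delta k q : dotp (delta_mx 0 k) q = q 0 k.
Proof.
rewrite /dotp (bigD1 k)//= mxE !eqxx mul1r big1 ?addr0// => j /negbTE jk.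
by rewrite mxE jk andbF mul0r.
Qed.

Lemma enorm_ge0 p : 0 <= enorm p.
Proof. exact: sqrtr_ge0. Qed.

Lemma enorm0 : enorm (0 : 'rV[R]_n) = 0.
Proof. by rewrite /enorm dot0p sqrtr0. Qed.

Lemma enormZ a p : enorm (a *: p) = `|a| * enorm p.
Proof.
rewrite /enorm dotpZl dotpC dotpZl mulrA -expr2 sqrtrM ?sqr_ge0//.
by rewrite sqrtr_sqr.
Qed.

Lemma coord_le_enorm p j : `|p 0 j| <= enorm p.
Proof.
rewrite -sqrtr_sqr ler_wsqrtr// /dotp (bigD1 j)//= -expr2 lerDl.
by apply: sumr_ge0 => k _; rewrite -expr2 sqr_ge0.
Qed.

(** Neighbourhoods are balls of the maximum norm while the hypotheses on H use the Euclidean one;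
    any comparison constant does. *)
Lemma enorm_le_norm p : enorm p <= n%:R * `|p|.
Proof.
have pj j : `|p 0 j| <= `|p|.
  rewrite [leRHS]/Num.norm /= mx_normrE.
  exact: (le_bigmax _ (fun ij => `|p ij.1 ij.2|) (0, j)).
rewrite -[leRHS]ger0_norm ?mulr_ge0// -sqrtr_sqr ler_wsqrtr//.
apply: (@le_trans _ _ (\sum_(j < n) `|p| ^+ 2)).
  apply: ler_sum => j _; rewrite -expr2 -(real_normK (num_real (p 0 j))).
  by rewrite lerXn2r ?nnegrE.
rewrite sumr_const card_ord -[leLHS]mulr_natl exprMn ler_wpM2r ?sqr_ge0//.
by rewrite -natrX ler_nat; case: (n) => // k; rewrite leq_pmulr.
Qed.

Lemma dotp_le p q : dotp p q <= enorm p * \sum_j `|q 0 j|.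
Proof.
rewrite mulr_sumr; apply: ler_sum => j _.
by rewrite (le_trans (ler_norm _))// normrM ler_wpM2r ?coord_le_enorm.
Qed.

End EuclideanSpace.

Section Subgradient.
Variables (R : realType) (n : nat).
Local Notation E := 'rV[R]_n.
Implicit Types (f : E -> R) (p q v w : E).

Definition convex_on_segments f := forall (t : R) p q, 0 <= t <= 1 ->
  f (t *: p + (1 - t) *: q) <= t * f p + (1 - t) * f q.

Lemma convex_functionT f :
  convex_function [set: E] f -> convex_on_segments f.
Proof.
move=> cf t p q /andP[t0 t1].
by have := cf (Itv01 t0 t1) p q; rewrite !inE; apply.
Qed.

(* Extension by one dimension as in the Hahn-Banach theorem: the slope along   *)
(* the new axis is a supremum of difference quotients taken on its negative    *)
(* side, and convexity bounds it by those taken on its positive side.          *)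
Lemma linear_minorant_step f (k : 'I_n) q : convex_on_segments f ->
  (forall v, (forall j : 'I_n, (k <= j)%N -> v 0 j = 0) -> dotp v q <= f v) ->
  exists q', forall v, (forall j : 'I_n, (k < j)%N -> v 0 j = 0) ->
    dotp v q' <= f v.
Proof.
move=> cf qf; pose e : E := delta_mx 0 k.
pose supp v := forall j : 'I_n, (k <= j)%N -> v 0 j = 0.
have slopes s v t w : 0 < s -> supp v -> 0 < t -> supp w ->
    (dotp v q - f (v - s *: e)) / s <= (f (w + t *: e) - dotp w q) / t.
  move=> s0 sv t0 sw; have st0 : 0 < s + t by rewrite addr_gt0.
  (* The weights t/(s+t) and s/(s+t) cancel the components along [e], so the convex combination
     falls in the subspace where [q] already works. *)
  have c01 : 0 <= t / (s + t) <= 1.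
    by rewrite divr_ge0 ?(ltW t0, ltW st0)// ler_pdivrMr// mul1r lerDr ltW.
  have cE : 1 - t / (s + t) = s / (s + t) by field; rewrite gt_eqF.
  have := cf _ (v - s *: e) (w + t *: e) c01; rewrite cE.
  have -> : t / (s + t) *: (v - s *: e) + s / (s + t) *: (w + t *: e) =
            t / (s + t) *: v + s / (s + t) *: w.
    apply/rowP => j; rewrite !mxE; ring.
  have /qf : supp (t / (s + t) *: v + s / (s + t) *: w).
    by move=> j kj; rewrite !mxE sv// sw// !mulr0 addr0.
  rewrite dotpDl !dotpZl => /le_trans /[apply].
  rewrite -(ler_pM2r st0) => h.
  rewrite ler_pdivrMr// mulrAC ler_pdivlMr//; move: h.
  set a := dotp v q; set b := dotp w q; set c := f _; set d := f _.
  have -> : (t / (s + t) * a + s / (s + t) * b) * (s + t) = t * a + s * b.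
    by field; rewrite gt_eqF.
  have -> : (t / (s + t) * c + s / (s + t) * d) * (s + t) = t * c + s * d.
    by field; rewrite gt_eqF.
  lra.
pose S := [set x | exists s v,
  [/\ 0 < s, supp v & x = (dotp v q - f (v - s *: e)) / s]].
have supp0 : supp 0 by move=> j _; rewrite mxE.
have S0 : S !=set0 by exists ((dotp 0 q - f (0 - 1 *: e)) / 1), 1, 0; split.
have Sub t w : 0 < t -> supp w -> ubound S ((f (w + t *: e) - dotp w q) / t).
  by move=> t0 sw _ [s [v [s0 sv ->]]]; exact: slopes.
have hS : has_sup S.
  by split => //; exists ((f (0 + 1 *: e) - dotp 0 q) / 1); exact: Sub.
(* The coordinate k of [q] is replaced by [sup S]; the others are kept. *)
exists (q + (sup S - q 0 k) *: e) => v hv.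
pose w := v - v 0 k *: e.
have sw : supp w.
  move=> j kj; rewrite !mxE eqxx/=; have [->|jk] := eqVneq j k.
    by rewrite mulr1 subrr.
  by rewrite mulr0 subr0 hv// ltn_neqAle kj andbT eq_sym.
have vE : v = w + v 0 k *: e by rewrite subrK.
have -> : dotp v (q + (sup S - q 0 k) *: e) = dotp w q + v 0 k * sup S.
  rewrite dotpC dotpDl dotpZl dotp_delta dotpC /w dotpBl dotpZl dotp_delta.
  ring.
have [s0|s0|s0] := ltgtP (v 0 k) 0.
- have : (dotp w q - f (w - (- v 0 k) *: e)) / (- v 0 k) <= sup S.
    by apply: sup_upper_bound => //; exists (- v 0 k), w; rewrite oppr_gt0.
  rewrite scaleNr opprK -vE ler_pdivrMr ?oppr_gt0//; lra.
- have : sup S <= (f (w + v 0 k *: e) - dotp w q) / v 0 k.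
    by apply: ge_sup => //; exact: Sub.
  rewrite -vE ler_pdivlMr//; lra.
- by rewrite s0 mul0r addr0 [in leRHS]vE s0 scale0r addr0 qf.
Qed.

Lemma linear_minorant f : convex_on_segments f -> 0 <= f 0 ->
  exists q, forall v, dotp v q <= f v.
Proof.
move=> cf f0.
have H k : (k <= n)%N -> exists q, forall v,
    (forall j : 'I_n, (k <= j)%N -> v 0 j = 0) -> dotp v q <= f v.
  elim: k => [_|k IH kn].
    exists 0 => v v0; have -> : v = 0 by apply/rowP => j; rewrite mxE v0.
    by rewrite dot0p.
  have [q qf] := IH (ltnW kn).
  exact: (@linear_minorant_step f (Ordinal kn) q).
have [q qf] := H n (leqnn n).
by exists q => v; apply: qf => j; rewrite leqNgt ltn_ord.
Qed.

(** Recentre at p and subtract f p, so that the minorant through the origin becomes a supporting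
    hyperplane. The form stated says that p maximises the expression whose supremum is the Legendre
    transform at q. *)
Lemma subgradient f p : convex_on_segments f ->
  exists q, forall v, dotp v q - f v <= dotp p q - f p.
Proof.
move=> cf; have [||q qf] := @linear_minorant (fun v => f (p + v) - f p).
- move=> t v w t01; rewrite -subr_ge0.
  have := cf t (p + v) (p + w) t01; rewrite -subr_ge0.
  have -> : t *: (p + v) + (1 - t) *: (p + w) = p + (t *: v + (1 - t) *: w).
    by apply/rowP => j; rewrite !mxE; ring.
  by move=> h; apply: le_trans h _; rewrite le_eqVlt; apply/orP; left;
    apply/eqP; ring.
- by rewrite addr0 subrr.
exists q => v; have := qf (v - p); rewrite [p + _]addrC subrK dotpBl; lra.
Qed.

End Subgradient.

(** * Lagrangians *)

Section Lagrangian.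
Variables (R : realType) (n m : nat).
Local Notation E := 'rV[R]_n.+1.
Variable H : 'I_m.+1 -> E -> E -> R.
Hypothesis hamH : hamiltonians H.

Lemma hamiltonian_subgradient i x p :
  exists q, lagrangian H i x q = (dotp p q - H i x p)%:E.
Proof.
have [_ cH _] := hamH.
have [q qH] := subgradient p (convex_functionT (cH i x)).
exists q; apply/eqP; rewrite eq_le; apply/andP; split.
  by apply: ge_ereal_sup => _ [v _ <-]; rewrite lee_fin.
by apply: ereal_sup_ubound; exists p.
Qed.

Lemma lagrangian_ge i x p q : ((dotp p q - H i x p)%:E <= lagrangian H i x q)%E.
Proof. by apply: ereal_sup_ubound; exists p. Qed.

(* Momenta outside a large ball do not compete in the supremum, uniformly in x. *)
Lemma superlinear_lower_bound q : exists r0, forall r, r0 <= r ->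
  forall i x p, r <= enorm p -> dotp p q - H i x p <= - r.
Proof.
have [_ _ [alpha [beta [sa _ aH]]]] := hamH.
pose c := \sum_j `|q 0 j|.
(* Slope c + 1 beats the linear growth c of [dotp p q] by one unit of [enorm p], whence the bound -
   r. *)
have /cvgryPge/(_ (c + 1))[r [_ rP]] := sa.
exists (Num.max r 0 + 1) => s; rewrite -lerBrDr ge_max => /andP[rs s1] i x p sp.
have s0 : 0 < s by lra.
have p0 : 0 < enorm p by rewrite (lt_le_trans s0).
have /rP : r < enorm p by lra.
rewrite ler_pdivlMr// => ap.
have /andP[aHp _] := aH i x p.
by have := dotp_le p q; rewrite -/c; nra.
Qed.

(** Outside a large ball the competitors are nonpositive by superlinearity; inside it, a subgradient
    q0 of H_i(x, .) at 0 bounds H_i from below by an affine function. *)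
Lemma lagrangian_lty i x q : (lagrangian H i x q < +oo)%E.
Proof.
have [r0 r0P] := superlinear_lower_bound q.
have [_ cH _] := hamH.
have [q0 q0H] := subgradient 0 (convex_functionT (cH i x)).
pose r := Num.max r0 0.
pose c := \sum_j `|(q - q0) 0 j|.
have c0 : 0 <= c by apply: sumr_ge0.
have r_ge0 : 0 <= r by rewrite le_max lexx orbT.
apply: (@le_lt_trans _ _ (Num.max 0 (r * c - H i x 0))%:E); last by rewrite ltry.
apply: ge_ereal_sup => _ [p _ <-]; rewrite lee_fin le_max.
have [rp|pr] := leP r (enorm p).
  have := r0P r _ i x p rp; rewrite le_max lexx /= => /(_ isT) h.
  by rewrite (le_trans h) ?oppr_le0.
have := q0H p; rewrite dot0p => h.
have hc : dotp p (q - q0) <= enorm p * c by exact: dotp_le.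
have : enorm p * c <= r * c by rewrite ler_wpM2r// ltW.
rewrite dotpC dotpBl in hc; rewrite (dotpC q p) (dotpC q0 p) in hc.
by move=> ?; apply/orP; right; lra.
Qed.

Lemma lagrangian_usc i x q (e : R) : 0 < e -> exists2 d : R, 0 < d &
  forall y, enorm (y - x) < d ->
    (lagrangian H i y q <= lagrangian H i x q + e%:E)%E.
Proof.
move=> e0; have [r0 r0P] := superlinear_lower_bound q.
have [/(_ i) uH _ _] := hamH.
(* With r at least H_i(x, 0), momenta outside the ball contribute at most - H_i(x, 0), which is
   below L_i(x, q) (take p = 0). Inside, uniform continuity costs [e]. *)
pose r := Num.max r0 (Num.max 1 (H i x 0)).
have r_gt0 : 0 < r by rewrite !lt_max ltr01 orbT.
have [d d0 dP] := uH r r_gt0 e e0.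
exists d => // y yx; apply: ge_ereal_sup => _ [p _ <-].
have [rp|pr] := leP r (enorm p).
  have := lagrangian_ge i x 0 q; rewrite dot0p sub0r => h.
  apply: le_trans (leeDl _ (ltW _)); last by rewrite lte_fin.
  apply: le_trans h; rewrite lee_fin.
  rewrite (le_trans (r0P r _ i y p rp)) ?le_max ?lexx// lerN2.
  by rewrite !le_max lexx !orbT.
apply: le_trans (leeD2r _ (lagrangian_ge i x p q)).
rewrite -EFinD lee_fin.
have := dP y x p p pr pr yx; rewrite subrr enorm0 => /(_ d0).
by rewrite ltr_norml => /andP[]; lra.
Qed.

End Lagrangian.

(** * The matrix exponential to first order *)

Section MatrixExponential.
Variables (R : realType) (m : nat).
Implicit Types A : 'M[R]_m.+1.

Lemma cvg_mx_entry (u : nat -> 'M[R]_m.+1) A :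
  (forall i j, (u k i j @[k --> \oo] --> A i j)) -> u @ \oo --> A.
Proof.
move=> uA; apply/cvg_ballP => e e0.
have : \forall k \near \oo, forall ij : 'I_m.+1 * 'I_m.+1,
    ball (A ij.1 ij.2) e (u k ij.1 ij.2).
  apply: filter_forall => -[i j]; exact: (cvg_ball (uA i j)).
by apply: filterS => k hk; split => // i j; exact: (hk (i, j)).
Qed.

Lemma mx_entry_le_norm A i j : `|A i j| <= `|A|.
Proof.
rewrite [leRHS]/Num.norm /= mx_normrE.
exact: (le_bigmax _ (fun ij => `|A ij.1 ij.2|) (i, j)).
Qed.

(** The maximum norm is not submultiplicative; each product costs a factor equal to the
    dimension. *)
Lemma expr_entry_le A k i j : `|(A ^+ k) i j| <= (m.+1%:R * `|A|) ^+ k.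
Proof.
elim: k i j => [|k IH] i j.
  by rewrite !expr0 mxE; case: eqP => _; rewrite ?normr0 ?normr1.
rewrite !exprS -mulrA mulr_natl mxE (le_trans (ler_norm_sum _ _ _))//.
rewrite -[X in _ *+ X]card_ord -sumr_const ler_sum// => l _.
by rewrite normrM ler_pM ?mx_entry_le_norm.
Qed.

(** [expmx] is a [limn], which is meaningful only once the series is known to converge; entries are
    compared with a scalar exponential series. *)
Lemma cvg_expmx_entry A i j :
  \sum_(0 <= k < N) (A ^+ k) i j / k`!%:R @[N --> \oo] --> expmx A i j.
Proof.
pose u k : 'M[R]_m.+1 := k`!%:R^-1 *: A ^+ k.
have uE N i' j' :
    series u N i' j' = \sum_(0 <= k < N) (A ^+ k) i' j' / k`!%:R.
  by rewrite summxE; apply: eq_bigr => k _; rewrite mxE mulrC.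
have cu i' j' : cvgn (fun N => series u N i' j').
  under eq_fun do rewrite uE.
  apply: (@normed_cvg _ _ (fun k => (A ^+ k) i' j' / k`!%:R : R^o)).
  apply: series_le_cvg (is_cvg_series_exp_coeff (m.+1%:R * `|A|)) => k //=.
    by rewrite /exp_coeff/= divr_ge0// exprn_ge0// mulr_ge0.
  rewrite /exp_coeff/= normrM normfV normr_nat ler_wpM2r ?invr_ge0//.
  exact: expr_entry_le.
have uL : series u @ \oo --> expmx A.
  suff : cvgn (series u) by [].
  apply/cvg_ex; exists (\matrix_(i', j') limn (fun N => series u N i' j')).
  by apply: cvg_mx_entry => i' j'; rewrite mxE; exact: cu.
under eq_fun do rewrite -uE.
apply: (@continuous_cvg _ _ _ _ _ (series u) (fun M : 'M[R]_m.+1 => M i j)) => //.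
exact: coord_continuous.
Qed.

(** After the first two terms, h <= 1 allows h^2 to be factored out of every power, leaving a tail
    of the scalar exponential series. *)
Lemma expmx_first_order A (h : R) i j : 0 <= h <= 1 ->
  `|expmx (h *: A) i j - (i == j)%:R - h * A i j| <=
  h ^+ 2 * expR (m.+1%:R * `|A|).
Proof.
move=> /andP[h0 h1]; set K := m.+1%:R * `|A|.
have K0 : 0 <= K by rewrite mulr_ge0.
have c : (fun N => `|\sum_(0 <= k < N) ((h *: A) ^+ k) i j / k`!%:R
     - (i == j)%:R - h * A i j|) @ \oo -->
    `|expmx (h *: A) i j - (i == j)%:R - h * A i j|.
  apply: cvg_norm; apply: cvgB; last exact: cvg_cst.
  by apply: cvgB; [exact: cvg_expmx_entry|exact: cvg_cst].
rewrite -(cvg_lim _ c)//; apply: limr_le; first by apply/cvg_ex; eexists; exact: c.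
exists 2%N => // -[|[|N]]// _ /=.
rewrite big_nat_recl// big_nat_recl// expr0 expr1 !mxE fact0 factS fact0 !divr1.
set S := \sum_(_ <= _ < _) _.
have -> : (i == j)%:R + (h * A i j + S) - (i == j)%:R - h * A i j = S by ring.
rewrite /S (le_trans (ler_norm_sum _ _ _))//.
apply: (@le_trans _ _ (h ^+ 2 * \sum_(0 <= k < N) exp_coeff K k.+2)).
  rewrite mulr_sumr ler_sum// => k _.
  rewrite exprZn mxE normrM normfV normr_nat mulrA ler_wpM2r ?invr_ge0//.
  rewrite normrM ler_pM// ?expr_entry_le// ger0_norm ?exprn_ge0//.
  by rewrite -[k.+2]addn2 exprD ler_piMl ?exprn_ge0// exprn_ile1.
rewrite ler_wpM2l ?exprn_ge0//.
apply: (@le_trans _ _ (series (exp_coeff K) N.+2)).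
  rewrite /series/= 2?big_nat_recl//= addrA lerDr addr_ge0//.
    by rewrite /exp_coeff/= expr0 divr_ge0.
  by rewrite /exp_coeff/= expr1 divr_ge0.
apply: nondecreasing_cvgn_le; last exact: is_cvg_series_exp_coeff.
by apply: nondecreasing_series => k _ _; rewrite /exp_coeff/= divr_ge0 ?exprn_ge0.
Qed.

End MatrixExponential.

(** * Laws of the Markov chain for small times *)

Section IntegralBounds.
Local Open Scope ereal_scope.
Context d (T : measurableType d) (R : realType).

(* No measurability is needed: the integral is defined from suprema of         *)
(* integrals of simple functions, which are monotone in the integrand.         *)
Lemma le_integral_pointwise (mu : {measure set T -> \bar R}) (D : set T)
    (f g : T -> \bar R) : (forall x, D x -> f x <= g x) ->
  \int[mu]_(x in D) f x <= \int[mu]_(x in D) g x.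
Proof.
move=> fg; have fgD x : (f \_ D) x <= (g \_ D) x.
  by rewrite !patchE; case: ifPn => // /set_mem/fg.
rewrite /integral; apply: leeD; last rewrite leeN2.
- apply: ereal_sup_le => _ [h /= hf <-]; exists h => //= x.
  apply: le_trans (hf x) _; rewrite !funeposE.
  by rewrite ge_max !le_max fgD lexx orbT.
- apply: ereal_sup_le => _ [h /= hf <-]; exists h => //= x.
  apply: le_trans (hf x) _; rewrite !funenegE.
  by rewrite ge_max !le_max leeN2 fgD lexx orbT.
Qed.

Lemma integral_cstD_indic (Q : probability T R) (X : set T) (a b : R) :
  measurable X ->
  \int[Q]_w (a + b * \1_X w)%:E = a%:E + b%:E * Q X.
Proof.
move=> mX.
have iX : Q.-integrable setT (fun x => (\1_X x)%:E) by exact: integrable_indic.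
rewrite (_ : (fun w => (a + b * \1_X w)%:E) =
  (EFin \o cst a) \+ (EFin \o (fun w => b * \1_X w)%R)); last first.
  by apply/funext => w /=; rewrite EFinD.
rewrite integralD_EFin//; last 2 first.
- exact: finite_measure_integrable_cst.
- rewrite (_ : _ \o _ = fun w => b%:E * (\1_X w)%:E).
    exact: integrableZl.
  by apply/funext => w /=; rewrite EFinM.
have -> : \int[Q]_x (EFin \o cst a) x = a%:E.
  apply: etrans (integral_cst Q (@measurableT _ T) a%:E) _.
  by rewrite -[RHS]mule1; congr (_ * _); exact: probability_setT.
under [X in _ + X]eq_integral do rewrite /= EFinM.
by rewrite integralZl// integral_indic// setIT.
Qed.

Lemma integral_finite_valued (k : nat) (Q : probability T R)
    (X : 'I_k -> set T) (c : T -> 'I_k) (U : 'I_k -> R) :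
  (forall j, measurable (X j)) -> (forall w j, X j w <-> c w = j) ->
  \int[Q]_w (U (c w))%:E = \sum_j (U j)%:E * Q (X j).
Proof.
move=> mX Xc.
rewrite (_ : (fun w => (U (c w))%:E) =
  fun w => \sum_j (U j)%:E * (\1_(X j) w)%:E); last first.
  apply/funext => w; rewrite (bigD1 (c w))//= indicE mem_set ?mule1//; last first.
    exact/Xc.
  rewrite big1 ?adde0// => j jc; rewrite indicE memNset ?mule0//.
  by move/Xc => cj; rewrite cj eqxx in jc.
have iX j : Q.-integrable setT (fun x => (\1_(X j) x)%:E).
  exact: integrable_indic.
rewrite integral_sum//; last by move=> j; exact: integrableZl.
by apply: eq_bigr => j _; rewrite integralZl// integral_indic// setIT.
Qed.

Lemma mnormalize_gt0 (mu : {measure set T -> \bar R}) (Q : probability T R)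
    (U : set T) : 0 < mu setT -> mu setT < +oo ->
  mnormalize mu Q U = mu U * ((fine (mu setT))^-1)%:E.
Proof. by move=> mu0 muoo; rewrite /mnormalize gt_eqF// lt_eqF. Qed.

End IntegralBounds.

Section PathSpaceLaws.
Variables (R : realType) (m : nat) (P : probability (pathSpace R m) R).
Variable i : 'I_m.+1.

Lemma measurable_eval (t : R) j : 0 <= t ->
  measurable ([set w : rcll_path R m | w t = j] : set (pathSpace R m)).
Proof. by move=> t0; apply: sub_sigma_algebra; exists t, j. Qed.

Lemma expected_action_le (Q : probability (pathSpace R m) R)
    (F : 'I_m.+1 -> R -> \bar R) (c M h e : R) (A : set (pathSpace R m)) :
  measurable A -> 0 <= h -> c <= M ->
  (forall j s, 0 <= s <= h -> (F j s <= M%:E)%E) ->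
  (forall s, 0 <= s <= h -> (F i s <= c%:E)%E) ->
  (forall w : rcll_path R m, A w -> forall s, 0 <= s <= h -> w s = i) ->
  (Q (~` A) <= e%:E)%E ->
  (\int[Q]_w \int[lebesgue_measure]_(s in `[0%R, h])
     F ((w : rcll_path R m) s) s <= (h * (c + (M - c) * e))%:E)%E.
Proof.
move=> mA h0 cM FM Fc Ai QA.
have leb0h : lebesgue_measure (`[0%R, h]%classic : set R) = h%:E.
  rewrite lebesgue_measure_itv/= lte_fin; case: ifPn => [_|].
    by rewrite -EFinD subr0.
  by rewrite -leNgt => hle; congr EFin; apply/eqP; rewrite eq_le h0 hle.
have cst0h (k : R) (G : R -> \bar R) : (forall s, 0 <= s <= h -> (G s <= k%:E)%E) ->
    (\int[lebesgue_measure]_(s in `[0%R, h]) G s <= (h * k)%:E)%E.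
  move=> Gk; rewrite mulrC EFinM -leb0h -integral_cst//.
  by apply: le_integral_pointwise => s /=; rewrite in_itv/= => /Gk.
(* The cost of a path is at most h c on A and h M off A; this measurable majorant takes exactly
   these values. *)
apply: (@le_trans _ _ (\int[Q]_w (h * c + h * (M - c) * \1_(~` A) w)%:E)%E).
  apply: le_integral_pointwise => w _; rewrite indicE.
  have [Aw|nAw] := pselect (A w).
    rewrite memNset ?mulr0 ?addr0; last by apply.
    by apply: cst0h => s sh; rewrite Ai//; exact: Fc.
  rewrite mem_set// mulr1 -mulrDr addrC subrK.
  by apply: cst0h => s sh; exact: FM.
rewrite integral_cstD_indic//; last exact: measurableC.
rewrite [X in (_ <= X%:E)%E]mulrDr EFinD leeD2l// mulrA [leRHS]EFinM.
by rewrite lee_wpmul2l// lee_fin mulr_ge0// subr_ge0.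
Qed.

Hypothesis Pi : (0 < P (starts_at i))%E.

Lemma started_atE (A : set (pathSpace R m)) :
  started_at P i A =
  (P (A `&` starts_at i) * ((fine (P (starts_at i)))^-1)%:E)%E.
Proof.
have ev : mrestr P (measurable_starts_at i) setT = P (starts_at i).
  by rewrite /mrestr setTI.
have Pfin : P (starts_at i) \is a fin_num.
  by rewrite fin_num_measure//; exact: measurable_starts_at.
apply: etrans (mnormalize_gt0 P A _ _) _; last by congr (_ * (fine _)^-1%:E)%E.
- by apply: lt_le_trans Pi _; rewrite -ev.
- by apply: le_lt_trans (_ : _ <= P (starts_at i))%E _; [rewrite -ev|rewrite ltey_eq Pfin].
Qed.

Lemma started_at_start : started_at P i (starts_at i) = 1%E.
Proof.
have fi : P (starts_at i) \is a fin_num.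
  by rewrite fin_num_measure//; exact: measurable_starts_at.
rewrite started_atE setIid -{1}(fineK fi) -EFinM divff//.
by rewrite gt_eqF// fine_gt0// Pi ltey_eq fi.
Qed.

Lemma started_at_transition (B : 'M[R]_m.+1) (h : R) j :
  markov_chain B P -> 0 <= h ->
  started_at P i [set w : rcll_path R m | w h = j] =
  (expmx (- h *: B) i j)%:E.
Proof.
(* Only the times 0 and h matter: the Markov property is used at k = 0, and conditioning on the
   start cancels the initial mass. *)
move=> markovP h0; pose t l : R := if l is 0%N then 0 else h.
pose s l : 'I_m.+1 := if l is 0%N then i else j.
have := markovP 0%N t s (lexx _); rewrite /t /s /= subr0 => /(_ (fun l _ => _)).
have -> : cylinder t s 0 = starts_at i.
  by apply/seteqP; split => [w /(_ 0%N (leqnn _))//|w /= w0 [|]].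
have -> : cylinder t s 1 = [set w : rcll_path R m | w h = j] `&` starts_at i.
  apply/seteqP; split => [w hw|w /= [wh w0] [|[|]]//].
  by split; [exact: (hw 1%N)|exact: (hw 0%N)].
rewrite started_atE => ->; last by case.
rewrite muleC muleA.
have := started_at_start; rewrite started_atE setIid muleC => ->.
by rewrite mul1e.
Qed.

Lemma expectation_at (B : 'M[R]_m.+1) (h : R) (U : 'I_m.+1 -> R) :
  markov_chain B P -> 0 <= h ->
  (\int[started_at P i]_w (U ((w : rcll_path R m) h))%:E =
   (\sum_j U j * expmx (- h *: B) i j)%:E)%E.
Proof.
move=> markovP h0.
rewrite (@integral_finite_valued _ _ _ _ _
  (fun j => [set w : rcll_path R m | w h = j] : set (pathSpace R m))
  (fun w : pathSpace R m => (w : rcll_path R m) h))//; last first.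
  by move=> j; exact: measurable_eval.
rewrite -sumEFin; apply: eq_bigr => j _.
by rewrite (started_at_transition _ markovP).
Qed.

(* By right continuity it suffices to control the path at rational times,      *)
(* which makes the event measurable.                                           *)
Lemma path_stays (e : R) : 0 < e -> exists2 d : R, 0 < d &
  exists A : set (pathSpace R m), [/\ measurable A,
    forall w : rcll_path R m, A w -> forall s, 0 <= s < d -> w s = i &
    (started_at P i (~` A) <= e%:E)%E].
Proof.
move=> e0.
pose A (k : nat) : set (pathSpace R m) := [set w : rcll_path R m |
  forall r : rat, 0 <= (ratr r : R) < k.+1%:R^-1 -> w (ratr r) = i].
have mA k : measurable (A k).
  rewrite (_ : A k = ~` \bigcup_(r in [set: rat])
    (if 0 <= (ratr r : R) < k.+1%:R^-1
     then ~` [set w : rcll_path R m | w (ratr r) = i] else set0)); last first.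
    rewrite setC_bigcup; apply/seteqP; split => w Aw r; last move=> rk.
      by move=> _; case: ifPn => // rk; apply; exact: Aw.
    by have /= := Aw r Logic.I; rewrite rk => /contrapT.
  apply: measurableC; apply: countable_bigcupT_measurable => // r.
  case: ifPn => // /andP[r0 _]; apply: measurableC; exact: measurable_eval.
have right_cst (w : rcll_path R m) s : 0 <= s ->
    exists2 b : R, 0 < b & forall s', s < s' < s + b -> w s' = w s.
  move=> s0; have [/(_ s s0) [b /= b0 bP] _ _] := rcll_cadlag w.
  exists b => // s' /andP[ss' s'b]; apply: bP => //=.
  by rewrite distrC gtr0_norm ?subr_gt0// ltrBlDl.
have Ai k (w : rcll_path R m) : A k w ->
    forall s, 0 <= s < k.+1%:R^-1 -> w s = i.
  move=> Aw s /andP[s0 sk]; have [b b0 bP] := right_cst w s s0.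
  have /rat_in_itvoo[r] : s < Num.min (s + b) k.+1%:R^-1.
    by rewrite lt_min sk ltrDl b0.
  rewrite in_itv/= lt_min => /and3P[sr rb rk].
  by rewrite -(bP (ratr r)) ?sr// Aw// rk andbT ltW// (le_lt_trans s0).
(* Every path from i stays there for a positive time, so the increasing events A k exhaust a set of
   full measure and continuity from below applies. *)
have subA : starts_at i `<=` \bigcup_k A k.
  move=> w w0; have [b b0 bP] := right_cst w 0 (lexx _).
  have [k _ /(_ k (leqnn _)) /= kb] := near_infty_natSinv_lt (PosNum b0).
  exists k => // r /andP[]; rewrite le_eqVlt => /predU1P[<- _//|r0 rk].
  by rewrite bP// ?r0 ?add0r// (lt_trans rk).
have ndA : {homo A : k l / (k <= l)%N >-> (k <= l)%O}.
  move=> k l kl; apply/subsetPset => w Aw r /andP[r0 rl]; apply: Aw.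
  by rewrite r0 (lt_le_trans rl)// lef_pV2 ?posrE// ler_nat.
have mUA : measurable (\bigcup_k A k) by exact: bigcupT_measurable.
have QU : started_at P i (\bigcup_k A k) = 1%E.
  apply/eqP; rewrite eq_le probability_le1//= -started_at_start.
  by rewrite le_measure// inE//; exact: measurable_starts_at.
have cvgA : started_at P i (A k) @[k --> \oo] --> 1%E.
  by rewrite -QU; exact: (@nondecreasing_cvg_mu _ _ _ (started_at P i)).
have : nbhs (1%E : \bar R) [set x | ((1 - e)%:E < x)%E].
  apply: open_nbhs_nbhs; split; first exact: open_ereal_gt_ereal.
  by rewrite /= lte_fin gtrBl.
move=> /cvgA[k _ /(_ k (leqnn _)) /= kP].
exists k.+1%:R^-1; first by rewrite invr_gt0.
exists (A k); split => //; first exact: Ai.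
apply: le_trans (_ : 1 - started_at P i (A k) <= _)%E.
  by rewrite -probability_setC.
rewrite leeBlDr ?fin_num_measure// -leeBlDl//.
by rewrite -EFinB ltW.
Qed.

End PathSpaceLaws.

(** * Envelopes and lines *)

Section Envelope.
Variables (R : realType) (n : nat).
Local Notation E := 'rV[R]_n.+1.
Implicit Types (v : R * E -> R) (z : R * E).

(** [fine] sends infinite values to 0, so the envelope is the true limsup only when that is finite:
    it is at least v z, as z lies in all the neighbourhoods, and at most M. *)
Lemma usc_envE v z (M : R) : halfspace z ->
  (\forall z' \near within (@halfspace R n) (nbhs z), v z' <= M) ->
  (usc_env v z)%:E =
  limf_esup (fun z' => (v z')%:E) (within (@halfspace R n) (nbhs z)).
Proof.
move=> hz vM; rewrite /usc_env fineK//.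
rewrite fin_numElt; apply/andP; split.
  apply: (@lt_le_trans _ _ (v z)%:E); first by rewrite ltNyr.
  apply: le_ereal_inf_tmp => _ [V FV <-]; apply: ereal_sup_ubound.
  by exists z => //; apply: (nbhs_singleton FV).
apply: (@le_lt_trans _ _ M%:E); last by rewrite ltry.
apply: ge_ereal_inf; exists (ereal_sup [set (v z')%:E | z' in [set z' | v z' <= M]]).
  by exists [set z' | v z' <= M].
by apply: ge_ereal_sup => _ [z' /= vz' <-]; rewrite lee_fin.
Qed.

Section LocallyBounded.
Variables (v : R * E -> R) (z : R * E) (M : R).
Hypotheses (hz : halfspace z)
  (vM : \forall z' \near within (@halfspace R n) (nbhs z), v z' <= M).

Lemma usc_env_ge : v z <= usc_env v z.
Proof.
rewrite -lee_fin (usc_envE hz vM).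
apply: le_ereal_inf_tmp => _ [V FV <-]; apply: ereal_sup_ubound.
by exists z => //; apply: (nbhs_singleton FV).
Qed.

Lemma usc_env_near_le (e : R) : 0 < e ->
  \forall z' \near within (@halfspace R n) (nbhs z), v z' <= usc_env v z + e.
Proof.
move=> e0; have : (limf_esup (fun z' => (v z')%:E)
    (within (@halfspace R n) (nbhs z)) < (usc_env v z + e)%:E)%E.
  by rewrite -(usc_envE hz vM) lte_fin ltrDl.
move=> /ereal_inf_lt[_ [V FV <-]] supV.
apply: filterS FV => z' Vz'; rewrite -lee_fin; apply: le_trans (ltW supV).
by apply: ereal_sup_ubound; exists z'.
Qed.

Lemma usc_env_adherent (e : R) (V : set (R * E)) : 0 < e -> nbhs z V ->
  exists z', [/\ V z', halfspace z' & usc_env v z - e < v z'].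
Proof.
move=> e0 zV; have : ((usc_env v z - e)%:E <
    ereal_sup [set (v z')%:E | z' in V `&` @halfspace R n])%E.
  apply: (@lt_le_trans _ _ (usc_env v z)%:E).
    by rewrite lte_fin gtrBl.
  rewrite (usc_envE hz vM); apply: ereal_inf_lbound.
  by exists (V `&` @halfspace R n) => //; apply: filterS zV => z' Vz' ?.
by move=> /ereal_sup_gt[_ [z' [Vz' hz'] <-]]; rewrite lte_fin => ?; exists z'.
Qed.

End LocallyBounded.
End Envelope.

Section Lines.
Variables (R : realType) (n : nat).
Local Notation E := 'rV[R]_n.+1.

Lemma derive1_line (x q : E) (s : R) : derive1 (fun r => x - r *: q) s = - q.
Proof.
rewrite /derive1; apply: cvg_lim => //; apply: cvg_near_cst.
near=> h; have h0 : h != 0 by near: h; exact: nbhs_dnbhs_neq.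
rewrite opprB addrA [x - _ + _ - _](_ : _ = - (h *: q)).
  by rewrite scalerN scalerA mulVf// scale1r.
by rewrite scalerDl; apply/rowP => j; rewrite !mxE; ring.
Unshelve. all: by end_near. Qed.

Lemma loc_abs_continuous_line (x q : E) :
  loc_abs_continuous (fun r : R => x - r *: q).
Proof.
move=> T T0 e e0; have q0 : 0 < enorm q + 1.
  by rewrite ltr_wpDl ?enorm_ge0.
exists (e / (enorm q + 1)); first by rewrite divr_gt0.
move=> k a b ab _ abd.
have -> : \sum_l enorm (x - b l *: q - (x - a l *: q)) =
    (\sum_l (b l - a l)) * enorm q.
  rewrite mulr_suml; apply: eq_bigr => l _.
  have -> : x - b l *: q - (x - a l *: q) = (a l - b l) *: q.
    by apply/rowP => j; rewrite !mxE; ring.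
  by rewrite enormZ distrC ger0_norm// subr_ge0; have [_ []] := ab l.
have S0 : 0 <= \sum_l (b l - a l).
  by apply: sumr_ge0 => l _; rewrite subr_ge0; have [_ []] := ab l.
apply: (@le_lt_trans _ _ ((\sum_l (b l - a l)) * (enorm q + 1))).
  by rewrite ler_wpM2l// lerDl.
by rewrite -ltr_pdivlMr.
Qed.

Lemma derive_time_space (phi : R * E -> R) (z : R * E) (q : E) :
  differentiable phi z ->
  'D_((1, q) : R * E) phi z = time_deriv phi z + dotp (space_grad phi z) q.
Proof.
move=> dphi; rewrite /time_deriv !deriveE//.
have -> : ((1, q) : R * E) =
    (1, 0) + \sum_j q 0 j *: ((0, delta_mx 0 j) : R * E).
  have -> : \sum_j q 0 j *: ((0, delta_mx 0 j) : R * E) = (0, q).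
    rewrite [in RHS](row_sum_delta q).
    rewrite (big_morph (fun y : E => (0, y) : R * E) (id1 := 0) (op1 := +%R))//.
      by apply: eq_bigr => j _; congr (_, _); rewrite scaler0.
    by move=> a b; congr (_, _); rewrite addr0.
  by congr (_, _) => /=; rewrite ?addr0 ?add0r.
rewrite linearD linear_sum; congr (_ + _); apply: eq_bigr => j _.
by rewrite linearZ /= mxE deriveE// mulrC.
Qed.

(** The lines used below run backward in time; the quotient is minus the one in the direction -
    v. *)
Lemma backward_difference_cvg (phi : R * E -> R) (z v : R * E) :
  differentiable phi z ->
  (phi z - phi (z - h *: v)) / h @[h --> 0^'+] --> 'D_v phi z.
Proof.
move=> dphi; have /cvg_ex[l dl] : derivable phi z (- v) by exact: diff_derivable.
have -> : 'D_v phi z = - l.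
  rewrite -[l](cvg_lim _ dl)// -/(derive _ _ _) !deriveE//.
  by rewrite linearN opprK.
rewrite (_ : (fun h => _) =
    fun h => - (h^-1 *: ((phi \o shift z) (h *: - v) - phi z))).
  by apply: cvgN; exact: cvg_dnbhs_at_right.
apply/funext => h /=; rewrite scalerN [- _ + z]addrC -[RHS]scalerN opprB.
exact: mulrC.
Qed.

End Lines.

(** * From sub-optimality to the differential inequality *)

Section AlongLines.
Variables (R : realType) (n m : nat).
Local Notation E := 'rV[R]_n.+1.
Variables (H : 'I_m.+1 -> E -> E -> R) (B : 'M[R]_m.+1)
  (P : probability (pathSpace R m) R) (u : 'I_m.+1 -> R * E -> R).
Hypotheses (markovP : markov_chain B P)
  (startP : forall i : 'I_m.+1, (0 < P (starts_at i))%E)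
  (subu : suboptimality H P u).

(** The curve leaves z.2 with velocity - q while time decreases from z.1 to z.1 - h, so the
    Lagrangians are evaluated at q. [U] majorises u at the endpoint, and its expectation is
    explicit. *)
Lemma suboptimality_line (i : 'I_m.+1) (z : R * E) (q : E) (h c M e : R)
    (A : set (pathSpace R m)) (U : 'I_m.+1 -> R) :
  0 <= h <= z.1 -> c <= M -> measurable A ->
  (forall w : rcll_path R m, A w -> forall s, 0 <= s <= h -> w s = i) ->
  (started_at P i (~` A) <= e%:E)%E ->
  (forall j, u j (z - h *: (1, q)) <= U j) ->
  (forall j s, 0 <= s <= h -> (lagrangian H j (z.2 - s *: q) q <= M%:E)%E) ->
  (forall s, 0 <= s <= h -> (lagrangian H i (z.2 - s *: q) q <= c%:E)%E) ->
  u i z - \sum_j U j * expmx (- h *: B) i j <= h * (c + (M - c) * e).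
Proof.
move=> /andP[h0 hz] cM mA Ai Ae uU LM Lc.
have t0 : 0 <= z.1 - h by rewrite subr_ge0.
have := subu t0 h0 i (loc_abs_continuous_line z.2 q).
rewrite subrK scale0r subr0 -surjective_pairing => le1.
rewrite -lee_fin EFinB.
apply: le_trans (_ : _ <= (u i z)%:E - \int[started_at P i]_w
    (u ((w : rcll_path R m) h) (z.1 - h, z.2 - h *: q)%R)%:E)%E _.
  apply: leeB => //; rewrite -(expectation_at (startP i) _ markovP)//.
  apply: le_integral_pointwise => w _; rewrite lee_fin.
  suff -> : (z.1 - h, z.2 - h *: q) = z - h *: (1, q) by exact: uU.
  by case: (z) => t x; congr (_, _); rewrite /= [_ *: _]mulr1.
apply: le_trans le1 _.
apply: (@expected_action_le _ _ i (started_at P i)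
  (fun j s => lagrangian H j (z.2 - s *: q)
     (- derive1 (fun r => z.2 - r *: q) s)) c M h e A) => //.
- by move=> j s sh; rewrite derive1_line opprK; exact: LM.
- by move=> s sh; rewrite derive1_line opprK; exact: Lc.
Qed.

End AlongLines.

Lemma transition_rate (R : realType) (m : nat) (B : 'M[R]_m.+1) i j :
  (expmx (- h *: B) i j - (i == j)%:R) / h @[h --> 0^'+] --> - B i j.
Proof.
pose C := expR (m.+1%:R * `|- B|).
have hC0 : h * C @[h --> 0^'+] --> (0 : R).
  rewrite -[X in _ --> X](mul0r C).
  by apply: cvgMr_tmp; apply: cvg_at_right_filter; exact: cvg_id.
apply: (@squeeze_cvgr _ _ _ _ (fun h => - B i j - h * C)
  (fun h => - B i j + h * C)).
- near=> h.
  have h0 : 0 < h by near: h; exact: nbhs_right_gt.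
  have h1 : h <= 1 by near: h; exact: nbhs_right_le.
  have := @expmx_first_order _ _ (- B) h i j; rewrite ltW// h1 => /(_ isT).
  rewrite scalerN -scaleNr mxE -/C.
  set a := expmx _ i j; set d := _%:R.
  have -> : a - d - h * - B i j = ((a - d) / h + B i j) * h.
    by field; rewrite gt_eqF.
  rewrite normrM (gtr0_norm h0) expr2 -mulrA [h * (h * C)]mulrC ler_pM2r//.
  by rewrite ler_norml => /andP[? ?]; apply/andP; split; lra.
- by rewrite -[X in _ --> X]subr0; apply: cvgB => //; exact: cvg_cst.
- by rewrite -[X in _ --> X]addr0; apply: cvgD => //; exact: cvg_cst.
Unshelve. all: by end_near. Qed.

Lemma le_of_le_addC (R : realType) (a b C : R) :
  (forall e, 0 < e <= 1 -> a <= b + e * C) -> a <= b.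
Proof.
move=> h; rewrite leNgt; apply/negP => ba.
have K0 : 0 < `|C| + 1 by rewrite ltr_wpDl.
pose e := Num.min 1 ((a - b) / 2 / (`|C| + 1)).
have e0 : 0 < e by rewrite lt_min ltr01 !divr_gt0// subr_gt0.
have := h e; rewrite e0 ge_min lexx => /(_ isT).
have : e * (`|C| + 1) <= (a - b) / 2.
  by rewrite -ler_pdivlMr// ge_min lexx orbT.
have := ler_norm C; nra.
Qed.

Section SubSolution.
Variables (R : realType) (n m : nat).
Local Notation E := 'rV[R]_n.+1.
Variables (H : 'I_m.+1 -> E -> E -> R) (B : 'M[R]_m.+1)
  (P : probability (pathSpace R m) R) (u : 'I_m.+1 -> R * E -> R).
Hypotheses (hamH : hamiltonians H) (markovP : markov_chain B P)
  (startP : forall i : 'I_m.+1, (0 < P (starts_at i))%E)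
  (bndu : locally_bounded_above u) (subu : suboptimality H P u).

Lemma locally_bounded_component j z : halfspace z -> exists M : R,
  \forall z' \near within (@halfspace R n) (nbhs z), u j z' <= M.
Proof. by move=> /bndu[M uM]; exists M; apply: filterS uM => z'; apply. Qed.

Lemma near_halfspace (z : R * E) : 0 < z.1 -> \forall z' \near z, halfspace z'.
Proof.
move=> z0; have : \forall s \near z.1, 0 <= s.
  exact: (cvgr_ge z.1 (@cvg_id _ (nbhs z.1)) 0 z0).
exact: cvg_fst.
Qed.

(* The principle is applied from a point z' depending on h at which u_i nearly *)
(* attains its envelope, so that the error h ^+ 2 is negligible against h.     *)
Lemma test_function_step (t : R) (x : E) (i : 'I_m.+1) phi (q : E)
    (l M e : R) :
  0 < t -> C1_near phi (t, x) ->
  (\forall z' \near (t, x),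
     usc_env (u i) z' - phi z' <= usc_env (u i) (t, x) - phi (t, x)) ->
  lagrangian H i x q = l%:E -> (forall j, lagrangian H j x q <= M%:E)%E ->
  0 < e ->
  \forall h \near 0^'+,
    usc_env (u i) (t, x) - h ^+ 2 -
    \sum_j (if j == i then usc_env (u i) (t, x) - phi (t, x) +
                           phi ((t, x) - h *: (1, q)) + h ^+ 2
            else usc_env (u j) (t, x) + e) * expmx (- h *: B) i j <=
    h * (l + e + (M - l) * e).
Proof.
move=> t0 C1phi maxphi Ll LM e0.
set z := (t, x); set v : R * E := (1, q).
have hz : halfspace z by exact: ltW.
have [d d0 [A [mA Ai Ae]]] := path_stays (startP i) e0.
have uscL j : exists2 r : R, 0 < r & forall y, enorm (y - x) < r ->
    (lagrangian H j y q <= lagrangian H j x q + e%:E)%E.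
  exact: lagrangian_usc.
have nearL : \forall z' \near z, forall j,
    (lagrangian H j z'.2 q <= lagrangian H j x q + e%:E)%E.
  apply: (@filter_forall _ _ _ (nbhs z)) => j; have [r r0 rL] := uscL j.
  have xr : \forall y \near x, (lagrangian H j y q <= lagrangian H j x q + e%:E)%E.
    have k0 : 0 < r / n.+1%:R by rewrite divr_gt0.
    apply/nbhs_ballP; exists (r / n.+1%:R) => // y; rewrite -ball_normE /= => xy.
    apply: rL; rewrite (le_lt_trans (enorm_le_norm _))//.
    by rewrite distrC mulrC -ltr_pdivlMr.
  exact: (@cvg_snd _ _ (nbhs t) (nbhs x) _ _ xr).
have nearu : \forall z' \near z, forall j, halfspace z' ->
    u j z' <= usc_env (u j) z + e.
  apply: (@filter_forall _ _ _ (nbhs z)) => j; have [Mj Mju] := locally_bounded_component j hz.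
  exact: (usc_env_near_le hz Mju e0).
pose G z' := [/\ halfspace z',
  usc_env (u i) z' - phi z' <= usc_env (u i) z - phi z,
  (forall j, halfspace z' -> u j z' <= usc_env (u j) z + e),
  (forall j, (lagrangian H j z'.2 q <= lagrangian H j x q + e%:E)%E) &
  {for z', continuous phi}].
have nearG : \forall z' \near z, G z'.
  have nearC : \forall z' \near z, {for z', continuous phi}.
    apply: filterS C1phi => z' [dphi _]; exact: differentiable_continuous.
  near=> z'; split; near: z' => //.
  exact: near_halfspace.
have /nbhs_ballP[r /= r0 rG] := nearG.
near=> h.
have h0 : 0 < h by near: h; exact: nbhs_right_gt.
have hd : h < d by near: h; exact: nbhs_right_lt.
(* Half of the radius r is for the base point z', half for the displacement along the line. *)
have hr : h < r / 2 / (`|v| + 1).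
  by near: h; apply: nbhs_right_lt; rewrite !divr_gt0// ltr_wpDl.
have h20 : 0 < h ^+ 2 by rewrite exprn_gt0.
have hvr s : 0 <= s <= h -> s * `|v| < r / 2.
  move=> /andP[s0 sh]; apply: le_lt_trans (_ : h * (`|v| + 1) < _).
    by rewrite ler_pM// lerDl.
  by rewrite -ltr_pdivlMr// ltr_wpDl.
have Gline z' s : ball z (r / 2) z' -> 0 <= s <= h -> G (z' - s *: v).
  move=> zz' sh; apply: rG; rewrite -ball_normE /=.
  rewrite -ball_normE /= in zz'.
  have -> : z - (z' - s *: v) = (z - z') + s *: v by rewrite opprB addrCA [LHS]addrC.
  rewrite (le_lt_trans (ler_normD _ _))// [ltRHS]splitr ltrD// normrZ.
  by have /andP[s0 _] := sh; rewrite ger0_norm// hvr.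
have [_ _ _ _ cphi] : G (z - h *: v).
  by apply: Gline; [apply: ballxx; rewrite divr_gt0|rewrite ltW//= lexx].
have nearphi : \forall z' \near z, phi (z' - h *: v) <= phi (z - h *: v) + h ^+ 2.
  have : z' - h *: v @[z' --> z] --> z - h *: v.
    by apply: cvgB; [exact: cvg_id|exact: cvg_cst].
  move=> /(continuous_cvg _ cphi)/cvgr_le; apply.
  by rewrite ltrDl.
have nearz : nbhs z (ball z (r / 2) `&`
    [set z' | phi (z' - h *: v) <= phi (z - h *: v) + h ^+ 2]).
  by apply: filterI => //; apply: nbhsx_ballx; rewrite divr_gt0.
have [Mi Miu] := locally_bounded_component i hz.
have [z' [[zz' phiz'] _ uz']] := usc_env_adherent hz Miu h20 nearz.
have sh : 0 <= h <= h by rewrite (ltW h0) lexx.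
have [hh gi gu _ _] := Gline z' h zz' sh.
pose U j := if j == i then usc_env (u i) z - phi z + phi (z - h *: v) + h ^+ 2
  else usc_env (u j) z + e.
(* For j = i the maximality of z for [usc_env (u i) - phi] transfers the bound to phi, and
   continuity of phi at z - h v replaces z' by z at the cost of h^2. *)
have uU j : u j (z' - h *: v) <= U j.
  rewrite /U; case: eqP => [->|_]; last exact: gu.
  have [N Nu] := locally_bounded_component i hh.
  by have := usc_env_ge hh Nu; move: phiz' gi => /=; lra.
apply: le_trans (_ : _ <= u i z' - \sum_j U j * expmx (- h *: B) i j) _.
  by rewrite lerD2r ltW.
have lM : l <= M by rewrite -lee_fin -Ll.
apply: le_trans (@suboptimality_line R n m H B P u markovP startP subu
  i z' q h (l + e) (M + e) e A U _ _ mA _ Ae uU _ _) _.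
- by rewrite ltW//=; move: hh; rewrite /halfspace /= [_ *: _]mulr1 subr_ge0.
- by rewrite lerD2r.
- move=> w Aw s /andP[s0 s1]; apply: Ai Aw _ _; first by rewrite s0 (le_lt_trans s1).
- move=> j s sh'; have [_ _ _ gL _] := Gline z' s zz' sh'.
  by apply: le_trans (gL j) _; rewrite EFinD leeD2r.
- move=> s sh'; have [_ _ _ gL _] := Gline z' s zz' sh'.
  by apply: le_trans (gL i) _; rewrite Ll EFinD.
- by have -> : M + e - (l + e) = M - l by ring.
Unshelve. all: by end_near. Qed.

Lemma suboptimality_subsolution : subsolution H B u.
Proof.
move=> t x t0 i pt px [phi [C1phi maxphi [-> ->]]].
set z := (t, x); set p := space_grad phi z.
have [q Lq] := hamiltonian_subgradient hamH i x p.
set l := dotp p q - H i x p in Lq.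
have [M LM] : exists M : R, forall j, (lagrangian H j x q <= M%:E)%E.
  exists (\sum_j `|fine (lagrangian H j x q)|) => j.
  have Lfin : lagrangian H j x q \is a fin_num.
    rewrite fin_numElt (lagrangian_lty hamH) andbT.
    by apply: lt_le_trans (lagrangian_ge H j x 0 q); rewrite ltNyr.
  rewrite -(fineK Lfin) lee_fin (le_trans (ler_norm _))//.
  by rewrite (bigD1 j)//= lerDl sumr_ge0.
have dphi : differentiable phi z by have /nbhs_singleton[] := C1phi.
(* The slack [e] granted to the components j != i reappears multiplied by their rates, hence by S in
   total. *)
pose S := \sum_(j | j != i) B i j.
apply: (@le_of_le_addC _ _ _ (1 + (M - l) - S)) => e /andP[e0 e1].
have step := test_function_step t0 C1phi maxphi Lq LM e0.
pose U h j := if j == i then usc_env (u i) z - phi z +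
                             phi (z - h *: (1, q)) + h ^+ 2
            else usc_env (u j) z + e.
pose U0 j := if j == i then usc_env (u i) z else usc_env (u j) z + e.
have hid : h @[h --> 0^'+] --> (0 : R).
  by apply: cvg_at_right_filter; exact: cvg_id.
have cU j : U h j @[h --> 0^'+] --> U0 j.
  rewrite /U /U0; case: eqP => _; last exact: cvg_cst.
  have -> : usc_env (u i) z = usc_env (u i) z - phi z + phi (z - 0 *: (1, q)) + 0 ^+ 2.
    by rewrite scale0r subr0 subrK expr0n addr0.
  apply: cvgD; last exact: (cvgM hid hid).
  apply: cvgD; first by rewrite scale0r subr0 subrK expr0n addr0; exact: cvg_cst.
  apply: continuous_cvg.
    by rewrite scale0r subr0; exact: differentiable_continuous.
  by apply: cvgB; [exact: cvg_cst|apply: cvgZr_tmp].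
(* The term 2 h collects the two errors h^2, from the base point and from phi, after division by
   h. *)
have lim_lhs : (phi z - phi (z - h *: (1, q))) / h - 2 * h
    - \sum_j U h j * ((expmx (- h *: B) i j - (i == j)%:R) / h) @[h --> 0^'+] -->
    'D_((1, q) : R * E) phi z - 2 * 0 - \sum_j U0 j * - B i j.
  apply: cvgB; first apply: cvgB.
  - exact: backward_difference_cvg.
  - by apply: cvgM => //; exact: cvg_cst.
  - apply: cvg_big => [|j _]; first exact: add_continuous.
    by apply: cvgM => //; exact: transition_rate.
have : 'D_((1, q) : R * E) phi z - 2 * 0 - \sum_j U0 j * - B i j <=
    l + e + (M - l) * e.
  apply: (@ler_cvg_to _ (0 : R)^'+ _ _ _ _ _ _ lim_lhs (cvg_cst _)).
  near=> h; have h0 : 0 < h by near: h; exact: nbhs_right_gt.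
  have h_neq0 : h != 0 by rewrite gt_eqF.
  rewrite -(ler_pM2r h0) [leRHS]mulrC.
  apply: le_trans (_ : _ <= usc_env (u i) z - h ^+ 2 -
    \sum_j U h j * expmx (- h *: B) i j) _; last by near: h; exact: step.
  rewrite mulrBl mulrBl (divfK h_neq0) mulr_suml.
  (* Splitting off the identity matrix isolates [U h i], whose envelope value cancels the one at z
     and leaves only the increment of phi. *)
  have -> : \sum_j U h j * expmx (- h *: B) i j = U h i +
      \sum_j U h j * ((expmx (- h *: B) i j - (i == j)%:R) / h) * h.
    have UE j : U h j * ((expmx (- h *: B) i j - (i == j)%:R) / h) * h =
        U h j * expmx (- h *: B) i j - U h j * (i == j)%:R.
      by rewrite -mulrA (divfK h_neq0) mulrBr.
    rewrite (eq_bigr _ (fun j _ => UE j)) sumrB [X in _ - X](bigD1 i)//= eqxx mulr1.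
    rewrite [X in _ - (_ + X)]big1 => [|j].
      by rewrite addr0 [RHS]addrC subrK.
    by rewrite eq_sym => /negbTE ->; rewrite mulr0.
  rewrite {2}/U eqxx.
  set T := \sum_j _; rewrite le_eqVlt; apply/orP; left; apply/eqP; ring.
have -> : \sum_j U0 j * - B i j = - (\sum_j B i j * usc_env (u j) z + e * S).
  rewrite mulr_sumr (bigD1 i)//= [in RHS](bigD1 i)//= /U0 eqxx.
  rewrite mulrN [_ * B i i]mulrC -addrA -big_split/= opprD; congr (_ + _).
  rewrite -sumrN; apply: eq_bigr => j /negbTE ->; ring.
rewrite (derive_time_space q dphi) -/p.
rewrite /l; set D := time_deriv _ _; set V := \sum_j _.
rewrite -/p; lra.
Unshelve. all: by end_near. Qed.

End SubSolution.

Theorem theorem5p4 (R : realType) (n m : nat)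
  (H : 'I_m.+1 -> 'rV[R]_n.+1 -> 'rV[R]_n.+1 -> R) (B : 'M[R]_m.+1)
  (P : probability (pathSpace R m) R) (u : 'I_m.+1 -> R * 'rV[R]_n.+1 -> R)
  (hamH : hamiltonians H) (coupB : coupling_matrix B)
  (markovP : markov_chain B P)
  (startP : forall i : 'I_m.+1, (0 < P (starts_at i))%E)
  (bndu : locally_bounded_above u) (subu : suboptimality H P u) :
  subsolution H B u.
Proof. exact: (suboptimality_subsolution hamH markovP startP bndu subu). Qed.
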